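(* Let $M$ be an oriented matroid on ground set $E$, and let $\mathcal B(M)$ be its set of bases. For each basis $B\in\mathcal B(M)$ let $A_B\subset E\setminus B$ be a subset. If the collection $\{B^{A_B}: B\in\mathcal B(M)\}$ of bases of the Lawrence polytope $\Lambda(M)$ satisfies the non-overlapping property (in $\Lambda(M)$), then it is a triangulation of $\Lambda(M)$.
   Context: Oriented matroids are finite. A signed circuit $C$ is written $C=(C^+,C^-)$, with support $\underline C$. Let $M$ have rank $r$ and ground set $E$, and let $\overline E=\{\overline e:e\in E\}$ be a disjoint copy of $E$; for $X\subset E$, $\overline X=\{\overline e:e\in X\}$. The Lawrence polytope (Lawrence lifting) $\Lambda(M)$ is the oriented matroid of rank $|E|+r$ on $\mathcal E=E\sqcup\overline E$ whose set of signed circuits is $\{(C^+\cup\overline{C^-},\ \overline{C^+}\cup C^-): (C^+,C^-) \text{ a signed circuit of } M\}$. For a basis $B$ of $M$ and $A\subset E\setminus B$ put $B^A:=B\cup\overline B\cup A\cup\overline{E\setminus(A\cup B)}$; these sets are precisely the bases of $\Lambda(M)$. For an oriented matroid $N$ and a collection of bases $B_1,\dots,B_t$ of $N$: - Non-overlapping property: there do not exist $B_i,B_j$ in the collection and a signed circuit $C=(C^+,C^-)$ of $N$ such that $C^+\subset B_i$ and $\underline C\setminus a\subset B_j$ for some $a\in C^+$. - Pseudo-manifold property: for any $B_i$ and $e\in B_i$, the set $B_i\setminus e$ is either contained in another $B_j$ ($j\ne i$) of the collection, or its complement contains a positive cocircuit of $N$ (the support of a signed cocircuit with no negative entries). A triangulation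 of $N$ is a collection of bases satisfying both properties. *)

(* Defs.v *)
From mathcomp Require Import all_boot.

Set Implicit Arguments.
Unset Strict Implicit.
Unset Printing Implicit Defensive.

(* A signed set X = (X^+, X^-) is the pair of its positive part X.1 and its
   negative part X.2; their disjointness is not part of the type. *)
Notation signed_set E := ({set E} * {set E})%type.

Section SignedSets.
Variable E : finType.
Implicit Types X Y : signed_set E.

Definition supp X : {set E} := X.1 :|: X.2.

Definition sopp X : signed_set E := (X.2, X.1).

(* With signs in {+, -, 0}: the set of products X(e) * Y(e) contains + if and
   only if it contains -. *)
Definition orthogonal X Y : bool :=
  (X.1 :&: Y.1 :|: X.2 :&: Y.2 == set0)
    == (X.1 :&: Y.2 :|: X.2 :&: Y.1 == set0).

End SignedSets.

(* The signed circuit axioms of Bjorner, Las Vergnas, Sturmfels, White and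
   Ziegler, with weak elimination. *)
Record oriented_matroid (E : finType) := OrientedMatroid {
  circuits : {set signed_set E};
  circuit_disjoint : forall X, X \in circuits -> [disjoint X.1 & X.2];
  circuit_nonempty : (set0, set0) \notin circuits;
  circuit_sopp : forall X, X \in circuits -> sopp X \in circuits;
  circuit_incomparable : forall X Y, X \in circuits -> Y \in circuits ->
    supp X \subset supp Y -> X = Y \/ X = sopp Y;
  circuit_elimination : forall X Y e, X \in circuits -> Y \in circuits ->
    X <> sopp Y -> e \in X.1 :&: Y.2 ->
    exists Z, [/\ Z \in circuits,
                  Z.1 \subset (X.1 :|: Y.1) :\ e
                & Z.2 \subset (X.2 :|: Y.2) :\ e]
}.

Section OrientedMatroids.
Variables (E : finType) (N : oriented_matroid E).

Definition independent (I : {set E}) : bool :=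
  [forall C in circuits N, ~~ (supp C \subset I)].

Definition bases : {set {set E}} := [set B | maxset independent B].

(* Circuits of the dual of the underlying matroid: the minimal sets contained
   in no complement of a basis. *)
Definition cocircuit_supports : {set {set E}} :=
  [set D | minset (fun D' => [forall B in bases, D' :&: B != set0]) D].

(* The signed cocircuits are the unique (up to sign) signatures of the
   cocircuits of the underlying matroid that are orthogonal to all signed
   circuits. *)
Definition cocircuits : {set signed_set E} :=
  [set D : signed_set E | [&& [disjoint D.1 & D.2], supp D \in cocircuit_supports
             & [forall C in circuits N, orthogonal C D]]].

Definition positive_cocircuit (P : {set E}) : Prop :=
  exists D, [/\ D \in cocircuits, D.2 = set0 & P = supp D].

Definition non_overlapping (T : {set {set E}}) : Prop :=
  ~ exists Bi Bj C a,
      [/\ Bi \in T, Bj \in T & C \in circuits N] /\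
      [/\ C.1 \subset Bi, a \in C.1 & supp C :\ a \subset Bj].

Definition pseudo_manifold (T : {set {set E}}) : Prop :=
  forall Bi e, Bi \in T -> e \in Bi ->
    (exists Bj, [/\ Bj \in T, Bj <> Bi & Bi :\ e \subset Bj]) \/
    (exists P, positive_cocircuit P /\ P \subset ~: (Bi :\ e)).

Definition triangulation (T : {set {set E}}) : Prop :=
  [/\ T \subset bases, non_overlapping T & pseudo_manifold T].

End OrientedMatroids.

(* The ground set of the Lawrence polytope is E + E, where inl e stands for e
   and inr e for its copy. *)
Section Lawrence.
Variable E : finType.

Definition lawrence_lift (C : signed_set E) : signed_set (E + E)%type :=
  (inl @: C.1 :|: inr @: C.2, inr @: C.1 :|: inl @: C.2).

Lemma inl_lawrence (X Y : {set E}) x :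
  (inl x \in (inl @: X :|: inr @: Y : {set E + E})) = (x \in X).
Proof.
rewrite inE (mem_imset _ _ (@inl_inj E E)).
by case: (x \in X) => //=; apply/imsetP => -[].
Qed.

Lemma inr_lawrence (X Y : {set E}) x :
  (inr x \in (inl @: X :|: inr @: Y : {set E + E})) = (x \in Y).
Proof.
rewrite inE (mem_imset _ _ (@inr_inj E E)) orbC.
by case: (x \in Y) => //=; apply/imsetP => -[].
Qed.

Lemma lawrence_lift_inj : injective lawrence_lift.
Proof.
move=> [X1 X2] [Y1 Y2] /(congr1 fst) /= /setP eqXY.
congr pair; apply/setP => x.
  by have := eqXY (inl x); rewrite !inl_lawrence.
by have := eqXY (inr x); rewrite !inr_lawrence.
Qed.

Lemma lawrence_lift_sopp C : lawrence_lift (sopp C) = sopp (lawrence_lift C).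
Proof. by congr pair; rewrite /= setUC. Qed.

Lemma lawrence_subset (X1 X2 Y1 Y2 : {set E}) :
  X1 \subset Y1 -> X2 \subset Y2 ->
  inl @: X1 :|: inr @: X2 \subset (inl @: Y1 :|: inr @: Y2 : {set E + E}).
Proof. by move=> s1 s2; apply: setUSS; apply: imsetS. Qed.

Variable M : oriented_matroid E.

Definition lawrence_circuits : {set signed_set (E + E)%type} :=
  lawrence_lift @: circuits M.

Lemma lawrence_disjoint X : X \in lawrence_circuits -> [disjoint X.1 & X.2].
Proof.
case/imsetP => C /circuit_disjoint dC -> /=.
rewrite disjoints_subset [inr @: C.1 :|: _]setUC; apply/subsetP => -[] x.
  rewrite in_setC !inl_lawrence => xC.
  by rewrite (disjointFr dC xC).
rewrite in_setC !inr_lawrence => xC.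
by rewrite (disjointFl dC xC).
Qed.

Lemma lawrence_nonempty : (set0, set0) \notin lawrence_circuits.
Proof.
apply/imsetP => -[C CM eC].
have /lawrence_lift_inj e0 : lawrence_lift (set0, set0) = lawrence_lift C.
  by rewrite -eC /lawrence_lift /= !imset0 !setU0.
by have := circuit_nonempty M; rewrite e0 CM.
Qed.

Lemma lawrence_sopp X : X \in lawrence_circuits -> sopp X \in lawrence_circuits.
Proof.
case/imsetP => C CM ->; rewrite -lawrence_lift_sopp.
by apply: imset_f; apply: circuit_sopp.
Qed.

Lemma lawrence_incomparable X Y :
  X \in lawrence_circuits -> Y \in lawrence_circuits ->
  supp X \subset supp Y -> X = Y \/ X = sopp Y.
Proof.
case/imsetP => C CM -> /imsetP[D DM ->] /subsetP sCD.
have suppE (F : signed_set E) x :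
    (inl x \in supp (lawrence_lift F)) = (x \in supp F).
  rewrite /supp /= [inr @: F.1 :|: _]setUC.
  by rewrite [LHS]in_setU !inl_lawrence in_setU.
have sCD' : supp C \subset supp D.
  by apply/subsetP => x; rewrite -!suppE; apply: sCD.
case: (circuit_incomparable CM DM sCD') => ->; [by left | right].
exact: lawrence_lift_sopp.
Qed.

Lemma lawrence_elimination X Y e :
  X \in lawrence_circuits -> Y \in lawrence_circuits ->
  X <> sopp Y -> e \in X.1 :&: Y.2 ->
  exists Z, [/\ Z \in lawrence_circuits,
                Z.1 \subset (X.1 :|: Y.1) :\ e
              & Z.2 \subset (X.2 :|: Y.2) :\ e].
Proof.
case/imsetP => C CM -> /imsetP[D DM ->] nCD eCD.
have {}nCD : C <> sopp D.
  by move=> eC; apply: nCD; rewrite eC lawrence_lift_sopp.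
have [Z [ZM s1 s2]] : exists Z, [/\ Z \in circuits M,
    Z.1 \subset (C.1 :|: D.1) :\ (match e with inl x | inr x => x end)
  & Z.2 \subset (C.2 :|: D.2) :\ (match e with inl x | inr x => x end)].
  case: e eCD => x; rewrite inE /= [inr @: D.1 :|: _]setUC.
    rewrite !inl_lawrence => xCD.
    by apply: circuit_elimination CM DM nCD _; rewrite inE.
  rewrite !inr_lawrence andbC => xDC.
  rewrite [C.1 :|: _]setUC [C.2 :|: _]setUC.
  apply: circuit_elimination DM CM _ _; last by rewrite inE.
  by move=> eD; apply: nCD; rewrite eD; case: (C).
move: s1 s2 => /subsetP s1 /subsetP s2.
exists (lawrence_lift Z); split; first exact: imset_f.
- apply/subsetP => -[] x; rewrite /= ?(inl_lawrence, inr_lawrence) => xZ;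
    [have := s1 x xZ | have := s2 x xZ];
    rewrite in_setD1 in_setU => /andP[nx xU];
    rewrite in_setD1 in_setU ?(inl_lawrence, inr_lawrence) xU andbT;
    by apply: contraNneq nx => <-.
- rewrite /= ![inr @: _ :|: inl @: _]setUC.
  apply/subsetP => -[] x; rewrite /= ?(inl_lawrence, inr_lawrence) => xZ;
    [have := s2 x xZ | have := s1 x xZ];
    rewrite in_setD1 in_setU => /andP[nx xU];
    rewrite in_setD1 in_setU ?(inl_lawrence, inr_lawrence) xU andbT;
    by apply: contraNneq nx => <-.
Qed.

Definition lawrence : oriented_matroid (E + E)%type :=
  OrientedMatroid lawrence_disjoint lawrence_nonempty lawrence_sopp
    lawrence_incomparable lawrence_elimination.

End Lawrence.

(* The set written B^A. *)
Definition lawrence_basis (E : finType) (B A : {set E}) : {set E + E} :=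
  inl @: B :|: inr @: B :|: inl @: A :|: inr @: (~: (A :|: B)).

(* Main.v *)
Require Import Defs.
From mathcomp Require Import all_boot.

Set Implicit Arguments.
Unset Strict Implicit.
Unset Printing Implicit Defensive.

(* Non-overlap says that if a circuit C of M agrees with the orientation A_B off
   B and C \ a lies in a basis B', then A_B' contains a with the sign C gives it.
   Fix a basis B^(A_B) and an element z over e.  If e is not in B, the pair of
   copies of e is a positive cocircuit avoiding B^(A_B) \ z.  If e is in B,
   orient every fundamental circuit of B by A_B.  If e always gets the sign of z
   (or 0), the fundamental cocircuit of e in B is positive and avoids
   B^(A_B) \ z.  Otherwise the elements f whose circuit gives e the other sign
   are candidates to replace e; comparing them through the circuits in B \ e
   plus two candidates gives a total preorder by non-overlap, and a most
   preferred f yields the adjacent basis. *)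

(** * Signs indexed by booleans *)

Section Parts.
Variable E : finType.
Implicit Types (X Y C : signed_set E) (x y : E).

(** With [true] for plus, reversing a signed set becomes [negb], and one argument serves both
    signs. *)
Definition part X (b : bool) : {set E} := if b then X.1 else X.2.

Lemma part_sopp X b : part (sopp X) b = part X (~~ b).
Proof. by case: b. Qed.

Lemma suppP X x : reflect (exists b, x \in part X b) (x \in supp X).
Proof.
rewrite inE; apply: (iffP orP) => [[h|h]|[[] h]].
- by exists true.
- by exists false.
- by left.
- by right.
Qed.

Lemma part_supp X b x : x \in part X b -> x \in supp X.
Proof. by move=> h; apply/suppP; exists b. Qed.

Lemma supp_sopp X : supp (sopp X) = supp X.
Proof. by rewrite /supp setUC. Qed.

Lemma sopp_inv X : sopp (sopp X) = X.
Proof. by case: X. Qed.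

End Parts.

(** * Circuits, bases and basis exchange *)

Section Matroid.
Variables (E : finType) (M : oriented_matroid E).
Implicit Types (X Y Z C : signed_set E) (I J B : {set E}) (x y e f g : E).

Lemma part_uniq X b c x :
  X \in circuits M -> x \in part X b -> x \in part X c -> b = c.
Proof.
move=> /circuit_disjoint dX.
by case: b c => [] [] //= h1 h2; have := disjointFr dX; [move/(_ _ h1)|move/(_ _ h2)];
  rewrite ?h1 ?h2.
Qed.

Lemma independentPn I :
  reflect (exists2 C, C \in circuits M & supp C \subset I) (~~ independent M I).
Proof.
apply: (iffP forall_inPn) => -[C CM]; first by rewrite negbK; exists C.
by move=> h; exists C => //; rewrite negbK.
Qed.

Lemma independent_circuit I C :
  independent M I -> C \in circuits M -> supp C \subset I -> False.
Proof. by move=> /forall_inP h /h /negP. Qed.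

Lemma circuit_in_independentU1 I C x :
  independent M I -> C \in circuits M -> supp C \subset x |: I -> x \in supp C.
Proof.
move=> iI CM sC; apply/negPn/negP => xC; apply: (independent_circuit iI CM).
apply/subsetP => y yC; have := subsetP sC y yC; rewrite !inE => /orP[/eqP yx|//].
by rewrite yx (negPf xC) in yC.
Qed.

(** The axiom covers [x] positive in [X]; the other case is the axiom with [X] and [Y]
    interchanged. *)
Lemma elimination X Y b x :
    X \in circuits M -> Y \in circuits M -> X <> sopp Y ->
    x \in part X b -> x \in part Y (~~ b) ->
  exists2 Z, Z \in circuits M & forall c y, y \in part Z c ->
    y != x /\ (y \in part X c \/ y \in part Y c).
Proof.
move=> XM YM nXY xX xY.
have [Z [ZM s1 s2]] : exists Z, [/\ Z \in circuits M,
    Z.1 \subset (X.1 :|: Y.1) :\ x & Z.2 \subset (X.2 :|: Y.2) :\ x].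
  case: b xX xY => /= xX xY.
    by apply: circuit_elimination => //; rewrite inE xX.
  rewrite [X.1 :|: _]setUC [X.2 :|: _]setUC.
  apply: circuit_elimination => //; last by rewrite inE xY.
  by move=> eY; apply: nXY; rewrite eY sopp_inv.
exists Z => // -[] y /=; [move/(subsetP s1)|move/(subsetP s2)];
  by rewrite !inE => /andP[-> /orP].
Qed.

Lemma circuit_with_sign X x b : X \in circuits M -> x \in supp X ->
  exists X', [/\ X' \in circuits M, supp X' = supp X & x \in part X' b].
Proof.
move=> XM /suppP[c xX]; have [<-|cb] := eqVneq c b; first by exists X.
exists (sopp X); rewrite supp_sopp part_sopp circuit_sopp //.
by split => //; move: xX cb; case: (b) c => [] [].
Qed.

(** Elimination in the underlying matroid: [Y] is reversed if need be, so that [x] has opposite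
    signs in the two circuits. *)
Lemma support_elimination X Y x :
    X \in circuits M -> Y \in circuits M -> supp X <> supp Y ->
    x \in supp X -> x \in supp Y ->
  exists2 Z, Z \in circuits M & supp Z \subset (supp X :|: supp Y) :\ x.
Proof.
move=> XM YM nXY /suppP[b xX] xY.
have [Y' [Y'M sY' xY']] := circuit_with_sign (~~ b) YM xY.
have nXY' : X <> sopp Y' by move=> eXY; case: nXY; rewrite -sY' eXY supp_sopp.
have [Z ZM sZ] := elimination XM Y'M nXY' xX xY'.
exists Z => //; apply/subsetP => y /suppP[d /sZ[yx yXY]].
rewrite in_setD1 yx in_setU -sY'.
by case: yXY => /part_supp ->; rewrite ?orbT.
Qed.

(** Eliminating [x] from two circuits with different supports would leave a circuit inside [J]. *)
Lemma unique_circuit J x X Y :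
    independent M J -> X \in circuits M -> Y \in circuits M ->
    supp X \subset x |: J -> supp Y \subset x |: J -> supp X = supp Y.
Proof.
move=> iJ XM YM sX sY.
have xX := circuit_in_independentU1 iJ XM sX.
have xY := circuit_in_independentU1 iJ YM sY.
apply/eqP/negPn/negP => nXY.
have [Z ZM sZ] : exists2 Z, Z \in circuits M & supp Z \subset (supp X :|: supp Y) :\ x.
  by apply: support_elimination => //; apply/eqP.
apply: (independent_circuit iJ ZM); apply: (subset_trans sZ).
by rewrite subDset subUset sX.
Qed.

(** Maximality can be tested on one-element extensions because independence passes to subsets. *)
Lemma basesP B :
  reflect (independent M B /\ forall x, x \notin B -> ~~ independent M (x |: B))
          (B \in bases M).
Proof.
rewrite inE; apply: (iffP maxsetP) => -[iB mB]; split=> //.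
  move=> x xB; apply/negP => /mB /(_ (subsetUr _ _)) eB.
  by move: xB; rewrite -eB setU11.
move=> J iJ sBJ; apply/eqP; rewrite eqEsubset sBJ andbT.
apply/subsetP => x xJ; apply/negPn/negP => /mB /independentPn[C CM sC].
apply: (independent_circuit iJ CM); apply: (subset_trans sC).
by rewrite subUset sub1set xJ.
Qed.

Lemma bases_independent B : B \in bases M -> independent M B.
Proof. by case/basesP. Qed.

(** The boolean [b] chooses between the two opposite orientations. The default value, which is not a
    circuit, is never reached for a basis [B] and [x] outside it. *)
Definition fundamental_circuit B x b : signed_set E :=
  odflt (set0, set0)
    [pick C in circuits M | (supp C \subset x |: B) && (x \in part C b)].

Lemma fundamental_circuitP B x b : B \in bases M -> x \notin B ->
  [/\ fundamental_circuit B x b \in circuits M,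
      supp (fundamental_circuit B x b) \subset x |: B
    & x \in part (fundamental_circuit B x b) b].
Proof.
move=> /basesP[iB mB] xB; rewrite /fundamental_circuit.
case: pickP => [C /and3P[]//|no].
have /independentPn[C CM sC] := mB x xB.
have xC := circuit_in_independentU1 iB CM sC.
have [C' [C'M sC' xC']] := circuit_with_sign b CM xC.
by have := no C'; rewrite C'M sC' sC xC'.
Qed.

(** By uniqueness, a circuit inside [f |: B :\ e] would have the support of [X], which contains [e].
    For maximality, adding [e] brings back [X]; for any other [g], the element [e] is eliminated
    with [X] from the circuit of [g] over [B], if it occurs there. *)
Lemma exchange_basis B e f X : B \in bases M -> e \in B -> f \notin B ->
    X \in circuits M -> supp X \subset f |: B -> e \in supp X ->
  f |: B :\ e \in bases M.
Proof.
move=> BM eB fB XM sX eX; have [iB mB] := basesP _ BM.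
have fX := circuit_in_independentU1 iB XM sX.
apply/basesP; split.
  apply/negPn/negP => /independentPn[Z ZM sZ].
  have sZ' : supp Z \subset f |: B.
    by apply: (subset_trans sZ); apply: setUS; apply: subD1set.
  move: eX; rewrite (unique_circuit iB XM ZM sX sZ') => /(subsetP sZ).
  by rewrite !inE eqxx orbF => /eqP ef; rewrite -ef eB in fB.
move=> g; rewrite !inE negb_or negb_and negbK => /andP[gf gB].
apply/independentPn; case: (eqVneq g e) gB => [-> _|ge /= gB].
  exists X => //; apply: (subset_trans sX); apply/subsetP => y.
  by rewrite !inE; case: (y == e); case: (y == f).
have /independentPn[C CM sC] := mB g gB.
have gC := circuit_in_independentU1 iB CM sC.
case: (boolP (e \in supp C)) => eC; last first.
  exists C => //; apply/subsetP => y yC; have := subsetP sC y yC.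
  rewrite !inE; case: (eqVneq y e) => [ye|_]; first by rewrite -ye yC in eC.
  by case/orP => -> //; rewrite !orbT.
have gX : g \notin supp X.
  by apply/negP => /(subsetP sX); rewrite !inE (negPf gf) (negPf gB).
have [Z ZM sZ] : exists2 Z, Z \in circuits M & supp Z \subset (supp C :|: supp X) :\ e.
  by apply: support_elimination => // eCX; move: gX; rewrite -eCX gC.
exists Z => //; apply: (subset_trans sZ); apply/subsetP => y.
rewrite in_setD1 in_setU => /andP[ye /orP[/(subsetP sC)|/(subsetP sX)]];
  by rewrite !inE ye => /orP[->|->]; rewrite ?orbT.
Qed.

(** Eliminate [e]. If [f] or [g] disappeared, the result would lie in the basis [g |: B :\ e] or
    [f |: B :\ e]. Each of them belongs to only one of [X] and [Y], so its sign is inherited. *)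
Lemma exchange_circuit B e f g X Y b :
    B \in bases M -> e \in B -> f \notin B -> g \notin B -> f != g ->
    X \in circuits M -> supp X \subset f |: B -> e \in part X b ->
    Y \in circuits M -> supp Y \subset g |: B -> e \in part Y (~~ b) ->
  exists Z, [/\ Z \in circuits M, supp Z \subset f |: (g |: B :\ e),
    forall c y, y \in part Z c -> y \in part X c \/ y \in part Y c,
    forall c, f \in part X c -> f \in part Z c
  & forall c, g \in part Y c -> g \in part Z c].
Proof.
move=> BM eB fB gB fg XM sX eX YM sY eY; have iB := bases_independent BM.
have fX := circuit_in_independentU1 iB XM sX.
have fY : f \notin supp Y.
  by apply/negP => /(subsetP sY); rewrite !inE (negPf fg) (negPf fB).
have gX : g \notin supp X.
  by apply/negP => /(subsetP sX); rewrite !inE eq_sym (negPf fg) (negPf gB).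
have [Z ZM sZ] : exists2 Z, Z \in circuits M & forall c y, y \in part Z c ->
    y != e /\ (y \in part X c \/ y \in part Y c).
  apply: elimination eX eY => // eXY.
  by move: fX; rewrite eXY supp_sopp (negPf fY).
have sZfg : supp Z \subset f |: (g |: B :\ e).
  apply/subsetP => y /suppP[c /sZ[ye]]; rewrite !inE ye.
  by case=> /part_supp; [move/(subsetP sX)|move/(subsetP sY)];
    rewrite !inE => /orP[]->; rewrite ?orbT.
exists Z; split=> //; first by move=> c y /sZ[].
- move=> c fXc.
  have iBg := bases_independent (exchange_basis BM eB gB YM sY (part_supp eY)).
  have /suppP[d fZ] := circuit_in_independentU1 iBg ZM sZfg.
  have [_ [fXd|/part_supp]] := sZ _ _ fZ; last by rewrite (negPf fY).
  by rewrite (part_uniq XM fXc fXd).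
- move=> c gYc; rewrite setUCA in sZfg.
  have iBf := bases_independent (exchange_basis BM eB fB XM sX (part_supp eX)).
  have /suppP[d gZ] := circuit_in_independentU1 iBf ZM sZfg.
  have [_ [/part_supp|gYd]] := sZ _ _ gZ; first by rewrite (negPf gX).
  by rewrite (part_uniq YM gYc gYd).
Qed.

(** * Orthogonality of a signed cocircuit to all circuits *)

Section Orthogonality.
Variables (D : {set E}) (s : E -> bool).

(* [I] is a basis of the hyperplane [~: D], and [s] signs the cocircuit [D] so
   that it is orthogonal to the circuits contained in [I] plus two elements. *)
Definition signed_hyperplane_basis I :=
  [/\ [disjoint I & D],
      forall f, f \in D -> independent M (f |: I),
      forall h, h \notin D -> h \notin I ->
        exists2 K, K \in circuits M & supp K \subset h |: I
    & forall f g, f \in D -> g \in D -> f != g ->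
        exists Z, [/\ Z \in circuits M, supp Z \subset f |: (g |: I),
          f \in part Z (s f) & g \in part Z (~~ s g)]].

(** [K] misses [D], so eliminating [a] with it changes no sign on [D]. Independence survives because
    every circuit in [h |: (f |: I)] has the support of [K], which contains [a]. *)
Lemma hyperplane_basis_exchange I h a K x : x \in D ->
    signed_hyperplane_basis I -> h \notin D -> h \notin I ->
    K \in circuits M -> supp K \subset h |: I -> a \in I -> a \in supp K ->
  signed_hyperplane_basis (h |: I :\ a).
Proof.
move=> xD [dI iI mI oI] hD hI KM sK aI aK.
have indI : independent M I.
  apply/negPn/negP => /independentPn[C CM sC].
  by apply: (independent_circuit (iI x xD) CM); apply: (subset_trans sC (subsetUr _ _)).
have hK := circuit_in_independentU1 indI KM sK.
have aD : a \notin D by rewrite (disjointFr dI aI).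
have iI' f : f \in D -> independent M (f |: (h |: I :\ a)).
  move=> fD; apply/negPn/negP => /independentPn[Z ZM sZ].
  have sZ' : supp Z \subset h |: (f |: I).
    rewrite setUCA; apply: (subset_trans sZ).
    by apply: setUS; apply: setUS; apply: subD1set.
  have sK' : supp K \subset h |: (f |: I).
    by apply: (subset_trans sK); apply: setUS; apply: subsetUr.
  move: aK; rewrite (unique_circuit (iI f fD) KM ZM sK' sZ') => /(subsetP sZ).
  rewrite !inE eqxx /= orbF => /orP[]/eqP eqa.
    by rewrite eqa fD in aD.
  by rewrite -eqa aI in hI.
split=> //.
- rewrite -setI_eq0; apply/eqP/setP => y; rewrite !inE.
  case: (eqVneq y h) => [->|_]; first by rewrite (negPf hD).
  by case: (boolP (y \in I)) => [/(disjointFr dI) ->|]; rewrite ?andbF.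
- move=> y yD; rewrite !inE negb_or negb_and negbK => /andP[yh yI].
  case: (eqVneq y a) yI => [-> _|ya /= yI].
    exists K => //; apply: (subset_trans sK); apply/subsetP => z.
    by rewrite !inE; case: (z == a); case: (z == h).
  have [Ky KyM sKy] := mI y yD yI.
  have yKy := circuit_in_independentU1 indI KyM sKy.
  case: (boolP (a \in supp Ky)) => aKy; last first.
    exists Ky => //; apply/subsetP => z zK; have := subsetP sKy z zK.
    rewrite !inE; case: (eqVneq z a) => [za|_]; first by rewrite -za zK in aKy.
    by case/orP => -> //; rewrite !orbT.
  have yK : y \notin supp K.
    by apply/negP => /(subsetP sK); rewrite !inE (negPf yh) (negPf yI).
  have [Z ZM sZ] : exists2 Z, Z \in circuits M & supp Z \subset (supp Ky :|: supp K) :\ a.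
    by apply: support_elimination => // eK; move: yK; rewrite -eK yKy.
  exists Z => //; apply: (subset_trans sZ); apply/subsetP => z.
  rewrite in_setD1 in_setU => /andP[za /orP[/(subsetP sKy)|/(subsetP sK)]];
    by rewrite !inE za => /orP[->|->]; rewrite ?orbT.
- move=> f g fD gD fg; have [Z [ZM sZ fZ gZ]] := oI f g fD gD fg.
  have notK y : y \in D -> y \notin supp K.
    move=> yD; apply/negP => /(subsetP sK); rewrite !inE => /orP[/eqP yh|yI].
      by rewrite -yh yD in hD.
    by rewrite (disjointFr dI yI) in yD.
  case: (boolP (a \in supp Z)) => aZ; last first.
    exists Z; split=> //; apply/subsetP => z zZ; have := subsetP sZ z zZ.
    rewrite !inE; case: (eqVneq z a) => [za|_]; first by rewrite -za zZ in aZ.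
    by case/or3P => ->; rewrite ?orbT.
  have /suppP[b aZb] := aZ.
  have [K' [K'M sK' aK']] := circuit_with_sign (~~ b) KM aK.
  have [Z' Z'M sZ'] : exists2 Z', Z' \in circuits M & forall c y, y \in part Z' c ->
      y != a /\ (y \in part Z c \/ y \in part K' c).
    apply: elimination aZb aK' => // eZ; have := notK f fD.
    by rewrite -sK' -supp_sopp -eZ (part_supp fZ).
  have sZ'fg : supp Z' \subset f |: (g |: (h |: I :\ a)).
    apply/subsetP => y /suppP[d /sZ'[ya]]; rewrite !inE ya.
    case=> /part_supp; first by
      move/(subsetP sZ); rewrite !inE => /or3P[]->; rewrite ?orbT.
    by rewrite sK' => /(subsetP sK); rewrite !inE => /orP[]->; rewrite ?orbT.
  have sign y d : y \in D -> y \in supp Z' -> y \in part Z d -> y \in part Z' d.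
    move=> yD /suppP[d' yZ'] yZ; have [_ [yZd'|/part_supp]] := sZ' _ _ yZ'.
      by rewrite (part_uniq ZM yZ yZd').
    by rewrite sK' (negPf (notK y yD)).
  exists Z'; split=> //.
    by apply: sign fZ => //; apply: (circuit_in_independentU1 (iI' g gD) Z'M).
  apply: sign gZ => //; apply: (circuit_in_independentU1 (iI' f fD) Z'M).
  by rewrite setUCA.
Qed.

(** Induction on the number of elements of [D] in [Z]. Independence of [f |: I] forces at least two,
    [f] and [g]. The circuit over [I] through both that agrees with [s] at [g] and not at [f] serves
    to eliminate [f], which leaves a smaller counterexample. *)
Lemma same_sign_circuit I x Z : x \in D -> signed_hyperplane_basis I ->
    Z \in circuits M -> supp Z :\: D \subset I ->
    (forall y, y \in D -> y \in supp Z -> y \in part Z (s y)) -> False.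
Proof.
move=> xD [dI iI _ oI].
have [n] := ubnP #|supp Z :&: D|; elim: n Z => // n IHn Z ltn ZM sZ pZ.
have other f : f \in D -> exists2 g, g \in D & (g \in supp Z) && (g != f).
  move=> fD; have [y yZ yfI] : exists2 y, y \in supp Z & y \notin f |: I.
    by apply/subsetPn/negP; apply: independent_circuit (iI f fD) ZM.
  move: yfI; rewrite !inE negb_or => /andP[yf yI]; exists y; last by rewrite yZ.
  by apply/negPn/negP => yD; move: yI; rewrite (subsetP sZ) // inE yD.
have [f fD /andP[fZ _]] := other x xD.
have [g gD /andP[gZ gf]] := other f fD.
have [Y [YM sY gY fY]] := oI g f gD fD gf.
have [Z' Z'M sZ'] : exists2 Z', Z' \in circuits M & forall c y, y \in part Z' c ->
    y != f /\ (y \in part Z c \/ y \in part Y c).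
  apply: elimination (pZ f fD fZ) fY => // eZ.
  have := pZ g gD gZ; rewrite eZ part_sopp => gY'.
  by have := part_uniq YM gY gY'; case: (s g).
have YD y : y \in D -> y \in supp Y -> y != f -> y = g.
  move=> yD /(subsetP sY); rewrite !inE => /or3P[/eqP //|/eqP->|yI].
    by rewrite eqxx.
  by rewrite (disjointFr dI yI) in yD.
apply: (IHn Z') => //.
- have sub : supp Z' :&: D \subset (supp Z :&: D) :\ f.
    apply/subsetP => y; rewrite [y \in _ :&: _]inE => /andP[/suppP[c /sZ'[yf yZY]] yD].
    rewrite in_setD1 yf in_setI yD andbT.
    by case: yZY => /part_supp // /(YD y yD) ->.
  have := subset_leq_card sub; rewrite (cardsD1 f (supp Z :&: D)) in ltn.
  by rewrite inE fZ fD /= in ltn; move=> h; apply: leq_ltn_trans h _.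
- apply/subsetP => y; rewrite inE => /andP[yD /suppP[c /sZ'[yf []/part_supp]]].
    by move=> yZ; apply: (subsetP sZ); rewrite inE yD.
  by move/(subsetP sY); rewrite !inE (negPf yf) /= => /orP[/eqP yg|//];
    rewrite yg gD in yD.
- move=> y yD /suppP[c yZ']; have [yf [yZ|yY]] := sZ' _ _ yZ'.
    by rewrite (part_uniq ZM (pZ y yD (part_supp yZ)) yZ).
  have yg := YD y yD (part_supp yY) yf; subst y.
  by rewrite (part_uniq YM gY yY).
Qed.

(** Extends orthogonality from circuits in [I] plus two elements to all circuits: [I] is exchanged
    towards [Z] until it contains the part of [Z] outside [D], where [same_sign_circuit] applies. *)
Lemma cocircuit_sign_change I Z x : signed_hyperplane_basis I ->
    Z \in circuits M -> x \in D -> x \in part Z (s x) ->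
  exists2 y, y \in D & y \in part Z (~~ s y).
Proof.
move=> hI ZM xD xZ.
have [J hJ sZJ] : exists2 J, signed_hyperplane_basis J & supp Z :\: D \subset J.
  have [n] := ubnP #|supp Z :\: I|; elim: n I hI => // n IHn I hI ltn.
  have [sZI|/subsetPn[h]] := boolP (supp Z :\: D \subset I); first by exists I.
  rewrite inE => /andP[hD hZ] hnI.
  have [_ iI mI _] := hI; have [K KM sK] := mI h hD hnI.
  (* Trading an [a] outside [Z] for [h] lowers the number of elements of [Z] missing from [I].
     Without such an [a], [K] would be [Z] up to sign, but [x] is in [Z] and not in [K]. *)
  have [a aK aZ] : exists2 a, a \in supp K & a \notin supp Z.
    apply/subsetPn/negP => sKZ.
    have xK : x \in supp K.
      have [eK|eK] := circuit_incomparable KM ZM sKZ;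
      by rewrite eK ?supp_sopp (part_supp xZ).
    have [dI _ _ _] := hI.
    have := subsetP sK x xK; rewrite !inE => /orP[/eqP xh|xI].
      by rewrite -xh xD in hD.
    by rewrite (disjointFr dI xI) in xD.
  have aI : a \in I.
    by have := subsetP sK a aK; rewrite !inE => /orP[/eqP ah|//]; rewrite ah hZ in aZ.
  apply: (IHn (h |: I :\ a)).
    exact: hyperplane_basis_exchange xD hI hD hnI KM sK aI aK.
  apply: leq_trans (_ : #|supp Z :\: I| <= n); last by [].
  apply: proper_card; apply/properP; split.
    apply/subsetP => y; rewrite 2!in_setD !inE !negb_or !negb_and negbK -in_setU.
    case/andP=> /andP[_ /orP[/eqP ya|->//]] yZ.
    by rewrite ya (negPf aZ) in yZ.
  by exists h; rewrite !inE -?in_setU ?hnI ?eqxx.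
have [/existsP[y /andP[yD yZ]]|/existsPn no] :=
  boolP [exists y, (y \in D) && (y \in part Z (~~ s y))]; first by exists y.
case: (same_sign_circuit xD hJ ZM sZJ) => y yD /suppP[c yZ].
have := no y; rewrite yD /=.
by case: (s y) c yZ => [] [] //= ->.
Qed.

End Orthogonality.

(** If a basis missed [P], adding [p0] to it would create a circuit meeting [P] only in [p0],
    against orthogonality. The bases of the last hypothesis give minimality of [P]. *)
Lemma positive_cocircuit_of_orthogonal (P : {set E}) p0 : p0 \in P ->
    (forall C p, C \in circuits M -> p \in C.1 -> p \in P ->
      exists2 q, q \in C.2 & q \in P) ->
    (forall p, p \in P -> exists2 K, K \in bases M & K :&: P \subset [set p]) ->
  positive_cocircuit M P.
Proof.
move=> p0P orth avoid; exists (P, set0); split=> //=; last by rewrite /supp setU0.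
have suppC : supp (P, set0) = P by rewrite /supp setU0.
have orth' C p : C \in circuits M -> p \in C.2 -> p \in P ->
    exists2 q, q \in C.1 & q \in P.
  by move=> CM pC pP; apply: (orth (sopp C) p) => //; apply: circuit_sopp.
rewrite inE suppC /=; apply/and3P; split.
- by rewrite -setI_eq0 setI0.
- rewrite inE; apply/minsetP; split.
    apply/forall_inP => K KM; apply/negP => /eqP PK0.
    have [iK mK] := basesP _ KM.
    have notK y : y \in P -> y \notin K.
      by move=> yP; apply/negP => yK; have := in_set0 y; rewrite -PK0 inE yP yK.
    have /independentPn[C CM sC] := mK p0 (notK p0 p0P).
    have onlyp0 y : y \in supp C -> y \in P -> y = p0.
      move=> /(subsetP sC); rewrite !inE => /orP[/eqP//|yK] /notK.
      by rewrite yK.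
    have dC := circuit_disjoint CM.
    have /suppP[[] /= p0C] := circuit_in_independentU1 iK CM sC.
      have [q qC qP] := orth C p0 CM p0C p0P.
      have qp := onlyp0 q (@part_supp _ C false q qC) qP; subst q.
      by rewrite (disjointFr dC p0C) in qC.
    have [q qC qP] := orth' C p0 CM p0C p0P.
    have qp := onlyp0 q (@part_supp _ C true q qC) qP; subst q.
    by rewrite (disjointFr dC qC) in p0C.
  move=> P' /forall_inP bP' sP'; apply/eqP; rewrite eqEsubset sP' /=.
  apply/subsetP => p pP; have [K KM sK] := avoid p pP.
  have /set0Pn[q] := bP' K KM; rewrite inE => /andP[qP' qK].
  have : q \in [set p] by rewrite (subsetP sK) // inE qK (subsetP sP').
  by rewrite inE => /eqP <-.
- apply/forall_inP => C CM; rewrite /orthogonal /= !setI0 setU0 set0U.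
  apply/eqP; apply/idP/idP; apply: contraTT => /set0Pn[p];
    rewrite inE => /andP[pC pP]; apply/set0Pn.
    by have [q qC qP] := orth' C p CM pC pP; exists q; rewrite inE qC.
  by have [q qC qP] := orth C p CM pC pP; exists q; rewrite inE qC.
Qed.

End Matroid.

(** * Elements, circuits and bases of the Lawrence polytope *)

Section LawrenceElements.
Variable E : finType.
Implicit Types (B A : {set E}) (x y : E) (C : signed_set E).

Definition copy (b : bool) x : (E + E)%type := if b then inl x else inr x.

Lemma copyE (y : E + E) : exists b x, y = copy b x.
Proof. by case: y => x; [exists true, x|exists false, x]. Qed.

(** The first copy keeps signs and the second reverses them, so the two booleans combine by
    equality. *)
Lemma in_part_lift b c x C :
  (copy b x \in part (lawrence_lift C) c) = (x \in part C (b == c)).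
Proof.
case: c; case: b; rewrite /= ?inl_lawrence ?inr_lawrence //;
  by rewrite setUC ?inl_lawrence ?inr_lawrence.
Qed.

Lemma in_lift1 b x C : (copy b x \in (lawrence_lift C).1) = (x \in part C b).
Proof. by rewrite -(eqb_id b) -in_part_lift eqb_id. Qed.

Lemma in_lift2 b x C : (copy b x \in (lawrence_lift C).2) = (x \in part C (~~ b)).
Proof. by rewrite -eqbF_neg -in_part_lift. Qed.

Lemma in_supp_lift b x C : (copy b x \in supp (lawrence_lift C)) = (x \in supp C).
Proof.
apply/suppP/suppP => -[c]; first by rewrite in_part_lift; exists (b == c).
move=> xC; exists (b == c); rewrite in_part_lift.
by move: xC; case: b; case: c.
Qed.

Lemma in_lawrence_basis b x B A :
  (copy b x \in lawrence_basis B A) = (x \in B) || ((x \in A) == b).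
Proof.
have -> : lawrence_basis B A = inl @: (B :|: A) :|: inr @: (B :|: ~: (A :|: B)).
  by rewrite !imsetU /lawrence_basis -!setUA; congr setU; rewrite setUCA.
case: b; rewrite /= ?inl_lawrence ?inr_lawrence !inE; first by case: (x \in A).
by case: (x \in A); case: (x \in B).
Qed.

Variable M : oriented_matroid E.

(** A lifted circuit contains both copies of each element of its support, and off [B] only one copy
    is present; so it would come from a circuit inside [B]. Adding the missing copy of [x] makes
    room for the lift of the circuit in [x |: B]. *)
Lemma lawrence_basis_bases B A :
  B \in bases M -> lawrence_basis B A \in bases (lawrence M).
Proof.
move=> /basesP[iB mB]; apply/basesP; split.
  apply/negPn/negP => /independentPn[_ /imsetP[C CM ->] /subsetP sC].
  apply: (independent_circuit iB CM); apply/subsetP => x xC.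
  have := sC (copy true x); have := sC (copy false x).
  rewrite !in_supp_lift !in_lawrence_basis => /(_ xC) h1 /(_ xC).
  by move: h1; case: (x \in B) => //=; case: (x \in A).
move=> z; have [b [x ->]] := copyE z.
rewrite in_lawrence_basis negb_or => /andP[xB xA].
have /independentPn[C CM sC] := mB x xB; apply/independentPn.
exists (lawrence_lift C); first exact: imset_f.
apply/subsetP => w; have [c [y ->]] := copyE w.
rewrite in_supp_lift in_setU1 in_lawrence_basis => /(subsetP sC).
rewrite !inE => /orP[/eqP->|->]; last by rewrite orbT.
rewrite (negPf xB) /=; have [->|cb] := eqVneq c b; first by rewrite eqxx.
by rewrite orbC; move: xA cb; case: (x \in A) b c => [] [] [].
Qed.

End LawrenceElements.

(** * Positive cocircuits and adjacent bases for the given collection *)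

Section Pseudomanifold.
Variables (E : finType) (M : oriented_matroid E) (A : {set E} -> {set E}).
Implicit Types (B : {set E}) (x y e f g h : E) (C X Z : signed_set E).

Notation T := [set lawrence_basis B (A B) | B in bases M].

(** This is exactly the condition that the positive part of the lift of [C] lies in
    [lawrence_basis B (A B)], the first half of an overlap. *)
Definition compatible B C :=
  forall x b, x \in part C b -> x \notin B -> (x \in A B) = b.

Lemma fundamental_circuit_compatible B f : B \in bases M -> f \notin B ->
  compatible B (fundamental_circuit M B f (f \in A B)).
Proof.
move=> BM fB x b xF xB; have [FM sF fF] := fundamental_circuitP (f \in A B) BM fB.
have := subsetP sF x (part_supp xF); rewrite !inE (negPf xB) orbF => /eqP xf.
by subst x; apply: part_uniq FM fF xF.
Qed.

(** Orthogonality holds because a lifted circuit containing one copy of [e] contains the other with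
    the opposite sign. *)
Lemma lawrence_pair_cocircuit B e : B \in bases M -> e \notin B ->
  positive_cocircuit (lawrence M) [set copy true e; copy false e].
Proof.
move=> BM eB.
have pairE p : p \in [set copy true e; copy false e] -> exists b, p = copy b e.
  by rewrite !inE => /orP[]/eqP->; [exists true | exists false].
have pairI b : copy b e \in [set copy true e; copy false e].
  by case: b; rewrite !inE eqxx ?orbT.
apply: (@positive_cocircuit_of_orthogonal _ _ _ (copy true e)) => //.
- move=> _ p /imsetP[C CM ->] + /pairE[b pE]; rewrite {}pE => pC.
  exists (copy (~~ b) e) => //; move: pC.
  by rewrite in_lift1 in_lift2 negbK.
- move=> _ /pairE[b ->]; exists (lawrence_basis B [set x | b]).
    exact: lawrence_basis_bases.
  apply/subsetP => q; rewrite in_setI => /andP[+ /pairE[c qE]].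
  by rewrite qE in_lawrence_basis (negPf eB) !inE /= => /eqP->.
Qed.

Section ReplaceElement.
Variables (B : {set E}) (e : E) (b0 : bool).
Hypotheses (BM : B \in bases M) (eB : e \in B).

Let F f := fundamental_circuit M B f (f \in A B).

Let FM f : f \notin B -> F f \in circuits M.
Proof. by move/(fundamental_circuitP (f \in A B) BM) => []. Qed.

Let sF f : f \notin B -> supp (F f) \subset f |: B.
Proof. by move/(fundamental_circuitP (f \in A B) BM) => []. Qed.

Let fF f : f \notin B -> f \in part (F f) (f \in A B).
Proof. by move/(fundamental_circuitP (f \in A B) BM) => []. Qed.

(* [D] is the fundamental cocircuit of [e] in [B]; when [e] never has sign
   [~~ b0] in the circuits [F f], its signature [s] is opposite to [A B]. *)
Lemma fundamental_cocircuit_positive :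
    (forall f, f \notin B -> e \notin part (F f) (~~ b0)) ->
  exists2 P, positive_cocircuit (lawrence M) P
    & P \subset ~: (lawrence_basis B (A B) :\ copy b0 e).
Proof.
move=> no.
pose D := [set x | (x == e) || (x \notin B) && (e \in supp (F x))].
pose s x := if x == e then b0 else x \notin A B.
have iB := bases_independent BM.
have eD : e \in D by rewrite inE eqxx.
have DP f : f \in D -> f != e -> f \notin B /\ e \in part (F f) b0.
  rewrite inE => /orP[->//|/andP[fB /suppP[c eF]]] _; split=> //.
  by have := no f fB; case: (b0) c eF => [] [] //= ->.
have exch f : f \in D -> f != e -> f |: B :\ e \in bases M.
  move=> fD fe; have [fB eF] := DP f fD fe.
  exact: exchange_basis BM eB fB (FM fB) (sF fB) (part_supp eF).
have sE f : f != e -> s f = (f \notin A B) by rewrite /s => /negPf->.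
have se : s e = b0 by rewrite /s eqxx.
have hI : signed_hyperplane_basis M D s (B :\ e).
  split.
  - rewrite -setI_eq0; apply/eqP/setP => x; rewrite !inE.
    by case: (x == e) => //=; case: (x \in B).
  - move=> f fD; have [->|fe] := eqVneq f e; first by rewrite setD1K.
    exact: bases_independent (exch f fD fe).
  - move=> h; rewrite in_setD1 inE negb_or !negb_and !negbK => /andP[he].
    rewrite (negPf he) /= => + hB; rewrite (negPf hB) /= => eF.
    exists (F h); first exact: FM.
    apply/subsetP => y yF; have := subsetP (sF hB) y yF.
    rewrite !inE; have [ye|//] := eqVneq y e.
    by rewrite -ye yF in eF.
  - move=> f g fD gD fg; have [fe|fe] := eqVneq f e.
      subst f; rewrite eq_sym in fg; have [gB eF] := DP g gD fg.
      exists (F g); rewrite FM // se sE // negbK fF //; split=> //.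
      by rewrite setUCA setD1K // sF.
    have [fB eF] := DP f fD fe; have [ge|ge] := eqVneq g e.
      subst g; exists (sopp (F f)); rewrite supp_sopp !part_sopp circuit_sopp ?FM //.
      by rewrite se negbK sE // negbK fF //; split=> //; rewrite setD1K // sF.
    have [gB eG] := DP g gD ge.
    (* Both circuits have sign [b0] at [e], so [F f] is reversed before [e] is eliminated; this also
       produces the signs that [s] demands at [f] and [g]. *)
    have [|||Z [ZM sZ _ fZ gZ]] := exchange_circuit (X := sopp (F f)) (Y := F g)
      (b := ~~ b0) BM eB fB gB fg (circuit_sopp (FM fB)) _ _ (FM gB) (sF gB) _.
    + by rewrite supp_sopp sF.
    + by rewrite part_sopp negbK.
    + by rewrite negbK.
    exists Z; split=> //; first by apply: fZ; rewrite part_sopp sE // negbK fF.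
    by apply: gZ; rewrite sE // negbK fF.
(* Off [B], [copy (s x) x] is the copy absent from [lawrence_basis B (A B)]; only [copy b0 e] is
   common to the two sets. *)
exists [set copy (s x) x | x in D].
  apply: (@positive_cocircuit_of_orthogonal _ _ _ (copy b0 e)).
  - by apply/imsetP; exists e; rewrite // se.
  - move=> _ p /imsetP[C CM ->] + /imsetP[x xD px]; rewrite {}px in_lift1 => xC.
    have [y yD yC] := cocircuit_sign_change hI CM xD xC.
    exists (copy (s y) y); last exact: imset_f.
    by rewrite in_lift2.
  - move=> _ /imsetP[f fD ->]; have [->|fe] := eqVneq f e.
      exists (lawrence_basis B (A B)); first exact: lawrence_basis_bases.
      apply/subsetP => q; rewrite in_setI => /andP[+ /imsetP[x xD eq]].
      rewrite eq inE in_lawrence_basis; have [->//|xe] := eqVneq x e.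
      have [xB _] := DP x xD xe.
      by rewrite (negPf xB) sE //; case: (x \in A B).
    (* Giving [e] the sign [~~ b0] excludes [copy b0 e], so the new basis meets the cocircuit only
       over [f]. *)
    pose A' := [set x | if x == e then ~~ b0 else x \in A B].
    exists (lawrence_basis (f |: B :\ e) A').
      by apply: lawrence_basis_bases; apply: exch.
    apply/subsetP => q; rewrite in_setI => /andP[+ /imsetP[x xD eq]].
    rewrite eq inE in_lawrence_basis !inE; have [->|xf /=] := eqVneq x f; first by [].
    have [->|xe] := eqVneq x e; first by rewrite se; case: (b0).
    have [xB _] := DP x xD xe.
    by rewrite (negPf xB) sE //; case: (x \in A B).
apply/subsetP => _ /imsetP[x xD ->].
rewrite in_setC in_setD1 negb_and negbK in_lawrence_basis.
have [->|xe] := eqVneq x e; first by rewrite se eqxx.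
have [xB _] := DP x xD xe.
by rewrite (negPf xB) sE //; case: (x \in A B); rewrite orbT.
Qed.

Hypothesis hno : non_overlapping (lawrence M) T.

(** Otherwise the second Lawrence basis contains the opposite copy of [a], hence the whole lifted
    support except perhaps [copy b a], and the lift of [C] witnesses an overlap. *)
Lemma non_overlapping_sign B1 B2 C b a : B1 \in bases M -> B2 \in bases M ->
    C \in circuits M -> compatible B1 C -> a \in part C b ->
    supp C :\ a \subset B2 ->
  (a \in A B2) = b.
Proof.
move=> B1M B2M CM cC aC sC; apply/eqP/negPn/negP => nab; apply: hno.
exists (lawrence_basis B1 (A B1)), (lawrence_basis B2 (A B2)).
exists (lawrence_lift C), (copy b a).
split; split; try exact: imset_f.
- apply/subsetP => z; have [c [x ->]] := copyE z.
  rewrite in_lift1 in_lawrence_basis => xC.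
  case: (boolP (x \in B1)) => //= xB.
  by rewrite (cC x c).
- by rewrite in_lift1.
- apply/subsetP => z; have [c [x ->]] := copyE z.
  rewrite in_setD1 in_supp_lift in_lawrence_basis => /andP[nz xC].
  have [xa|xa] := eqVneq x a; last by rewrite (subsetP sC) // in_setD1 xa.
  subst x; have cb : c != b by apply: contraNneq nz => ->.
  by move: nab cb; rewrite orbC; case: (a \in A B2) b c {aC nz} => [] [] [].
Qed.

(* If [f] and [g] are candidates to replace [e], call [f] preferable to [g]
   when [A] agrees at [g] on [B] and on [f |: B :\ e].  Non-overlap makes this
   relation total and transitive, so some candidate is preferable to all. *)
Lemma adjacent_basis f0 : f0 \notin B -> e \in part (F f0) (~~ b0) ->
  exists f, [/\ f \notin B, f |: B :\ e \in bases M,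
    (e \in A (f |: B :\ e)) = ~~ b0
  & forall g, g \notin B -> g != f -> (g \in A (f |: B :\ e)) = (g \in A B)].
Proof.
move=> f0B ef0.
pose cand := [set f | (f \notin B) && (e \in part (F f) (~~ b0))].
pose Bx f := f |: B :\ e.
have candP f : f \in cand -> f \notin B /\ e \in part (F f) (~~ b0).
  by rewrite inE => /andP[].
have BxM f : f \in cand -> Bx f \in bases M.
  case/candP => fB eF; exact: exchange_basis BM eB fB (FM fB) (sF fB) (part_supp eF).
have subBx f g Z : supp Z \subset f |: (g |: B :\ e) -> supp Z :\ g \subset Bx f.
  by move=> sZ; rewrite subDset setUCA.
have subBx' f g Z : supp Z \subset f |: (g |: B :\ e) -> supp Z :\ f \subset Bx g.
  by move=> sZ; rewrite subDset.
(* Eliminate [e] between [F f] and the reverse of [F g]. *)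
have opp f g : f \in cand -> g \in cand -> f != g -> exists Z,
    [/\ Z \in circuits M, supp Z \subset f |: (g |: B :\ e),
        f \in part Z (f \in A B) & g \in part Z (g \notin A B)].
  move=> /candP[fB eF] /candP[gB eG] fg.
  have [||Z [ZM sZ _ fZ gZ]] := exchange_circuit (X := F f) (Y := sopp (F g))
    BM eB fB gB fg (FM fB) (sF fB) eF (circuit_sopp (FM gB)) _ _.
  - by rewrite supp_sopp sF.
  - by rewrite part_sopp negbK.
  exists Z; split=> //; first by apply: fZ; apply: fF.
  by apply: gZ; rewrite part_sopp negbK fF.
pose pref f := [set h in cand | (h != f) && ((h \in A (Bx f)) == (h \in A B))].
have prefE f h : (h \in pref f) =
    [&& h \in cand, h != f & (h \in A (Bx f)) == (h \in A B)].
  by rewrite [LHS]in_set.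
(* Off [Bx f] the circuit [Z] contains only [g], with the sign opposite to [A B]. The assumed
   disagreement at [g] makes [Z] compatible with [Bx f], and non-overlap with [Bx g] fixes the sign
   of [f]. *)
have pref_total f g : f \in cand -> g \in cand -> f != g ->
    (g \in A (Bx f)) != (g \in A B) -> (f \in A (Bx g)) = (f \in A B).
  move=> fc gc fg nfg; have [Z [ZM sZ fZ gZ]] := opp f g fc gc fg.
  apply: (non_overlapping_sign (BxM f fc) (BxM g gc) ZM _ fZ (subBx' _ _ _ sZ)).
  move=> x c xZ xB; have := subsetP sZ x (part_supp xZ); move: xB.
  rewrite setUCA !in_setU1 !negb_or => /andP[/negPf-> /negPf->]; rewrite !orbF.
  move=> /eqP xg; subst x; rewrite -(part_uniq ZM gZ xZ).
  by move: nfg; case: (g \in A B); case: (g \in A _).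
(* Here [Z] passes through [g] and [h]; the two assumptions on [Bx f] make it compatible there, and
   non-overlap with [Bx g] fixes the sign of [h]. *)
have pref_trans f g h : f \in cand -> g \in cand -> h \in cand ->
    f != g -> g != h -> h != f ->
    (g \in A (Bx f)) != (g \in A B) -> (h \in A (Bx f)) = (h \in A B) ->
    (h \in A (Bx g)) = (h \in A B).
  move=> fc gc hc fg gh hf nfg pfh; rewrite eq_sym in gh.
  have [Z [ZM sZ hZ gZ]] := opp h g hc gc gh.
  apply: (non_overlapping_sign (BxM f fc) (BxM g gc) ZM _ hZ (subBx' _ _ _ sZ)).
  move=> x c xZ xB; have := subsetP sZ x (part_supp xZ); move: xB.
  rewrite !in_setU1 !negb_or => /andP[_ /negPf->]; rewrite !orbF.
  move=> /orP[]/eqP xg; subst x; first by rewrite -(part_uniq ZM hZ xZ).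
  rewrite -(part_uniq ZM gZ xZ).
  by move: nfg; case: (g \in A B); case: (g \in A _).
have f0c : f0 \in cand by rewrite inE f0B.
case: (arg_maxnP (fun f => #|pref f|) f0c) => f fc maxf.
have {}fc : f \in cand := fc.
have [fB eF] := candP f fc; exists f; split=> //; first exact: BxM.
  apply: (non_overlapping_sign BM (BxM f fc) (FM fB) _ eF).
    exact: fundamental_circuit_compatible.
  apply/subsetP => x; rewrite in_setD1 => /andP[xe /(subsetP (sF fB))].
  by rewrite !inE xe.
move=> g gB gf; rewrite -/(Bx f).
have cG := fundamental_circuit_compatible BM gB.
have [gc|gc] := boolP (g \in cand).
  (* If [f] were not preferable to [g], then [pref g] would contain [pref f] and also [f], against
     the maximality of [f]. *)
  apply/eqP/negPn/negP => nfg; rewrite eq_sym in gf.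
  have := maxf g gc; rewrite /= leqNgt => /negP; apply; apply: proper_card.
  apply/properP; split.
    apply/subsetP => h; rewrite 2!prefE => /and3P[hc hf /eqP pfh].
    have gh : g != h by apply: contraNneq nfg => ->; rewrite pfh.
    by rewrite hc eq_sym gh; apply/eqP; apply: pref_trans nfg pfh.
  exists f; last by rewrite prefE eqxx andbF.
  by rewrite prefE fc gf; apply/eqP; apply: pref_total.
(* If [F g] avoids [e], then removing [g] leaves it inside [B :\ e], and non-overlap applies
   directly. *)
have [eG|eG] := boolP (e \in supp (F g)); last first.
  apply: (non_overlapping_sign BM (BxM f fc) (FM gB) cG (fF gB)).
  apply/subsetP => x; rewrite in_setD1 => /andP[xg xF].
  have := subsetP (sF gB) x xF; rewrite !inE (negPf xg) /= => ->.
  by rewrite andbT; have [xe|_] := eqVneq x e; rewrite ?orbT // -xe xF in eG *.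
have {}eG : e \in part (F g) (~~ ~~ b0).
  have /suppP[c eGc] := eG; move: gc; rewrite inE gB /=.
  by case: (b0) c eGc => [] [] //= ->.
have fg : f != g by rewrite eq_sym.
(* [F f] and [F g] now have opposite signs at [e]. Eliminating [e] keeps the sign of [g] and
   compatibility with [B], which both circuits have. *)
have [Z [ZM sZ pZ _ gZ]] := exchange_circuit BM eB fB gB fg
  (FM fB) (sF fB) eF (FM gB) (sF gB) eG.
apply: (non_overlapping_sign BM (BxM f fc) ZM _ (gZ _ (fF gB)) (subBx _ _ _ sZ)).
move=> x c /pZ[xF|xG] xB; last exact: cG xG xB.
exact: fundamental_circuit_compatible xF xB.
Qed.

End ReplaceElement.

End Pseudomanifold.

Theorem proposition5p8 (E : finType) (M : oriented_matroid E)
  (A : {set E} -> {set E})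
  (hA : forall B : {set E}, B \in bases M -> A B \subset ~: B)
  (hno : non_overlapping (lawrence M)
           [set lawrence_basis B (A B) | B in bases M]) :
  triangulation (lawrence M) [set lawrence_basis B (A B) | B in bases M].
Proof.
split=> //.
  by apply/subsetP => _ /imsetP[B BM ->]; apply: lawrence_basis_bases.
move=> _ z /imsetP[B BM ->]; have [b [e ->]] := copyE z.
rewrite in_lawrence_basis; have [eB _|eB /= /eqP eA] := boolP (e \in B); last first.
  right; exists [set copy true e; copy false e].
  split; first exact: lawrence_pair_cocircuit BM eB.
  apply/subsetP => q; rewrite in_set2 in_setC in_setD1 => /orP[]/eqP->;
    rewrite in_lawrence_basis (negPf eB) eA /=; case: (b);
    by rewrite ?eqxx ?andbF.
have [/existsP[f0 /andP[f0B ef0]]|/existsPn no] := boolP [exists f,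
  (f \notin B) && (e \in part (fundamental_circuit M B f (f \in A B)) (~~ b))].
  have [f [fB fM eA gA]] := adjacent_basis BM eB hno f0B ef0; left.
  exists (lawrence_basis (f |: B :\ e) (A (f |: B :\ e))); split.
  - exact: imset_f.
  (* The new basis contains both copies of [f], the old one only one. *)
  - move=> /setP eqB; have := eqB (copy true f); have := eqB (copy false f).
    rewrite !in_lawrence_basis !inE eqxx (negPf fB) /=.
    by case: (f \in A B).
  - apply/subsetP => w; have [c [x ->]] := copyE w.
    rewrite in_setD1 !in_lawrence_basis !inE => /andP[nw].
    have [->//|xf] := eqVneq x f.
    (* The copy of [e] that remains has sign [~~ b], which is the sign [A] gives [e] at the new
       basis. *)
    have [xe _|xe /=] := eqVneq x e.
      subst x; rewrite eA /=; have cb : c != b by apply: contraNneq nw => ->.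
      by move: cb; case: (b) (c) => [] [].
    by have [//|xB /=] := boolP (x \in B); rewrite gA.
have [|P posP sP] := @fundamental_cocircuit_positive _ M A B e b BM eB.
  by move=> f fB; have := no f; rewrite fB.
by right; exists P.
Qed.
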